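(* Let $(S,\cdot)$ be a finite semigroup and $N=\lceil(2|S|+1)\log_2(|S|)\rceil$. For every $a\in S$ there exists a first-order formula $\mathbf{labelling}_a(x,y)$ with free variables $x,y$, over the signature consisting of a binary relation $<$ and unary predicates $p_1,\dots,p_N$, and to every ordinal $\alpha$ and additive labelling $\sigma$ from $\alpha$ to $S$ one can associate subsets $X_1(\alpha,\sigma),\dots,X_N(\alpha,\sigma)$ of $\alpha$, such that: (1) for all $a\in S$ and $x<y$ in $\alpha$, $\sigma(x,y)=a$ iff $(\alpha,X_1(\alpha,\sigma),\dots,X_N(\alpha,\sigma))\models\mathbf{labelling}_a(x,y)$ (with $p_i$ interpreted as $X_i(\alpha,\sigma)$); (2) (determinism) for all additive labellings $\sigma$ over an ordinal $\alpha$ and $\sigma'$ over an ordinal $\alpha'$ and every ordinal $\beta<\min(\alpha,\alpha')$, if $\sigma|_{\le\beta}=\sigma'|_{\le\beta}$ then for all $i$, $\beta\in X_i(\alpha,\sigma)$ iff $\beta\in X_i(\alpha',\sigma')$.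
   Context: An ordinal is identified with the well-ordered set of smaller ordinals. An additive labelling from $\alpha$ to $S$ assigns to each pair $x<y$ in $\alpha$ an element $\sigma(x,y)\in S$ with $\sigma(x,y)\sigma(y,z)=\sigma(x,z)$ for all $x<y<z$. $\sigma|_{\le\beta}$ denotes the restriction of $\sigma$ to pairs of elements of $[0,\beta]$. *)

(* Defs.v *)
From HB Require Import structures.
From mathcomp Require Import all_boot all_order all_algebra.
From mathcomp Require Import generic_quotient.
From mathcomp Require Import all_classical all_reals exp.
From mathcomp Require Import wochoice.

Set Implicit Arguments.
Unset Strict Implicit.
Unset Printing Implicit Defensive.

Import Order.TTheory.
Local Open Scope classical_set_scope.
Local Open Scope order_scope.
Local Open Scope quotient_scope.

(** The type [Ord] is the quotient of the well-ordered types (over some fixed but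
  arbitrary universe) by order isomorphism, ordered by "is isomorphic to a
  proper initial segment of".  It is itself well ordered, and every well order
  is isomorphic to the set of the ordinals smaller than its class ([ord_below]),
  so that an ordinal can be identified with the set of smaller ordinals. *)

Record wo := WO {
  wo_sort :> Type;
  wo_le : rel wo_sort;
  wo_leP : well_order wo_le
}.

Definition wo_lt (a : wo) (x y : a) : bool := ~~ wo_le y x.

Definition wo_iso (a b : wo) : Prop :=
  exists2 f : a -> b, bijective f & {mono f : x y / wo_le x y}.

Definition wo_prec (a b : wo) : Prop :=
  exists (f : a -> b) (y0 : b),
    {mono f : x y / wo_le x y} /\ forall y, range f y <-> wo_lt y y0.

Section WellOrder.
Variable a : wo.
Implicit Types x y z : a.

Lemma wo_min (P : a -> Prop) x :
  P x -> exists2 y, P y & forall z, P z -> wo_le y z.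
Proof.
move=> Px; have [|y [[Py yP] _]] := wo_leP (w := a) (A := [pred y | `[< P y >]]).
  by exists x; apply/asboolP.
by exists y => [|z Pz]; [apply/asboolP | apply/yP/asboolP].
Qed.

Lemma wo_total : total (@wo_le a).
Proof.
move=> x y; have [|z [->|->] zP] := @wo_min (fun z => z = x \/ z = y) x; first by left.
  by rewrite zP//; right.
by rewrite (zP x) ?orbT//; left.
Qed.

Lemma wo_refl : reflexive (@wo_le a).
Proof. by move=> x; have := wo_total x x; rewrite orbb. Qed.

Lemma wo_anti : antisymmetric (@wo_le a).
Proof.
move=> x y /andP[xy yx].
have [|z [_ zu]] := wo_leP (w := a) (A := [pred z | `[< z = x \/ z = y >]]).
  by exists x; apply/asboolP; left.
transitivity z; [symmetry|]; apply: zu; split.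
- by apply/asboolP; left.
- by move=> t /asboolP[]-> //; exact: wo_refl.
- by apply/asboolP; right.
- by move=> t /asboolP[]-> //; exact: wo_refl.
Qed.

Lemma wo_trans : transitive (@wo_le a).
Proof.
move=> y x z xy yz.
have [|t tP tm] := @wo_min (fun t => [\/ t = x, t = y | t = z]) x; first by constructor 1.
have tx : wo_le t x by apply: tm; constructor 1.
have ty : wo_le t y by apply: tm; constructor 2.
have tz : wo_le t z by apply: tm; constructor 3.
case: tP => tE; rewrite tE in tx ty tz.
- by [].
- by rewrite (@wo_anti x y)// xy tx.
- by rewrite -(@wo_anti y z) ?yz.
Qed.

Lemma wo_ltW x y : wo_lt x y -> wo_le x y.
Proof. by have := wo_total x y; rewrite /wo_lt; case: wo_le; case: wo_le. Qed.

Lemma wo_lt_le_trans x y z : wo_lt x y -> wo_le y z -> wo_lt x z.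
Proof. by rewrite /wo_lt => + yz; apply: contra => /(wo_trans yz). Qed.

Lemma wo_lt_irr x : wo_lt x x = false.
Proof. by rewrite /wo_lt wo_refl. Qed.

Lemma wo_ltP x y : [\/ wo_lt x y, x = y | wo_lt y x].
Proof.
rewrite /wo_lt; case yx: (wo_le y x); last by constructor 1.
case xy: (wo_le x y); last by constructor 3.
by constructor 2; apply: wo_anti; rewrite xy.
Qed.

Lemma wo_ind (P : a -> Prop) :
  (forall x, (forall y, wo_lt y x -> P y) -> P x) -> forall x, P x.
Proof.
move=> IH x; apply: contrapT => nPx.
have [y nPy ymin] := @wo_min (fun y => ~ P y) x nPx.
apply/nPy/IH => z zy; apply: contrapT => /ymin yz.
by move: zy; rewrite /wo_lt yz.
Qed.

Lemma mono_wo_lt (b : wo) (f : a -> b) :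
  {mono f : x y / wo_le x y} -> {mono f : x y / wo_lt x y}.
Proof. by move=> fm x y; rewrite /wo_lt fm. Qed.

Lemma wo_mono_ge (f : a -> a) :
  {mono f : x y / wo_le x y} -> forall x, wo_le x (f x).
Proof.
move=> /mono_wo_lt fm; elim/wo_ind => x IH; apply/negPn/negP => fxx.
have /IH : wo_lt (f x) x by [].
by apply/negP; change (wo_lt (f (f x)) (f x)); rewrite fm.
Qed.

End WellOrder.

Lemma mono_wo_inj (a b : wo) (f : a -> b) :
  {mono f : x y / wo_le x y} -> injective f.
Proof. by move=> fm x y fxy; apply: wo_anti; rewrite -!fm fxy wo_refl. Qed.

Lemma wo_iso_refl a : wo_iso a a.
Proof. by exists id => //; exists id. Qed.

Lemma wo_iso_sym a b : wo_iso a b -> wo_iso b a.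
Proof.
move=> [f [g fK gK] fm]; exists g; first by exists f.
by move=> x y; rewrite -fm !gK.
Qed.

Lemma wo_iso_trans a b c : wo_iso a b -> wo_iso b c -> wo_iso a c.
Proof.
move=> [f fb fm] [g gb gm]; exists (g \o f); first exact: bij_comp.
by move=> x y; rewrite /= gm fm.
Qed.

Lemma wo_prec_irr a : ~ wo_prec a a.
Proof.
move=> [f [y0 [fm /(_ (f y0)) [fy _]]]].
have := wo_mono_ge fm y0; have /fy : range f (f y0) by exists y0.
by rewrite /wo_lt => /negbTE->.
Qed.

Lemma wo_prec_isol a b c : wo_iso a b -> wo_prec b c -> wo_prec a c.
Proof.
move=> [f [g fK gK] fm] [h [y0 [hm hr]]]; exists (h \o f), y0; split.
  by move=> x y; rewrite /= hm fm.
move=> y; rewrite -hr; split=> [[x _ <-]|[x _ <-]]; first by exists (f x).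
by exists (g x); rewrite //= gK.
Qed.

Lemma wo_prec_isor a b c : wo_prec a b -> wo_iso b c -> wo_prec a c.
Proof.
move=> [h [y0 [hm hr]]] [f [g fK gK] fm]; exists (f \o h), (f y0); split.
  by move=> x y; rewrite /= fm hm.
move=> y; rewrite -[y]gK (mono_wo_lt fm) -hr.
split=> [[x _ /= xy]|[x _ <-]]; last by exists x.
by exists x => //; apply: (can_inj fK).
Qed.

Lemma wo_prec_trans a b c : wo_prec a b -> wo_prec b c -> wo_prec a c.
Proof.
move=> [f [y0 [fm fr]]] [g [z0 [gm gr]]]; exists (g \o f), (g y0); split.
  by move=> x y; rewrite /= gm fm.
move=> z; split=> [[x _ <-] /=|zy].
  by rewrite (mono_wo_lt gm) -fr; exists x.
have /gr[y _ yz] : wo_lt z z0.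
  by apply: wo_lt_le_trans zy (wo_ltW _); rewrite -gr; exists y0.
move: zy; rewrite -yz (mono_wo_lt gm) -fr => -[x _ <-].
by exists x.
Qed.

(* [wo_sim x y] holds when the initial segments below x and y are isomorphic *)
Inductive wo_sim (a b : wo) : a -> b -> Prop :=
  WoSim x y of
    (forall x', wo_lt x' x -> exists2 y', wo_lt y' y & wo_sim x' y') &
    (forall y', wo_lt y' y -> exists2 x', wo_lt x' x & wo_sim x' y') :
  wo_sim x y.

Lemma wo_simP (a b : wo) (x : a) (y : b) : wo_sim x y ->
  (forall x', wo_lt x' x -> exists2 y', wo_lt y' y & wo_sim x' y') /\
  (forall y', wo_lt y' y -> exists2 x', wo_lt x' x & wo_sim x' y').
Proof. by case. Qed.

Lemma wo_sim_fun (a b : wo) (x : a) (y y' : b) : wo_sim x y -> wo_sim x y' -> y = y'.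
Proof.
elim/wo_ind: x y y' => x IH.
suff main (y y' : b) : wo_sim x y -> wo_sim x y' -> ~ wo_lt y y'.
  by move=> y y' xy xy'; case: (wo_ltP y y') => // l; exfalso;
    [exact: main xy xy' l|exact: main xy' xy l].
move=> /wo_simP[sx _] /wo_simP[_ sy'] /sy'[x' xx' x'y].
have [y'' yy'' x'y''] := sx _ xx'.
by move: yy''; rewrite (IH _ xx' _ _ x'y'' x'y) wo_lt_irr.
Qed.

Lemma wo_sim_sym (a b : wo) (x : a) (y : b) : wo_sim x y -> wo_sim y x.
Proof.
elim/wo_ind: x y => x IH y /wo_simP[sx sy]; constructor.
  by move=> y' /sy[x' x'x ?]; exists x' => //; exact: IH.
by move=> x' x'x; have [y' ? ?] := sx _ x'x; exists y' => //; exact: IH.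
Qed.

Lemma wo_sim_lt (a b : wo) (x x' : a) (y y' : b) :
  wo_sim x y -> wo_sim x' y' -> wo_lt x x' -> wo_lt y y'.
Proof.
move=> xy /wo_simP[sx' _] /sx'[z zy' xz].
by rewrite (wo_sim_fun xy xz).
Qed.

Lemma wo_sim_mono (a b : wo) (f : a -> b) :
  (forall x, wo_sim x (f x)) -> {mono f : x y / wo_le x y}.
Proof.
move=> fs x y; apply/idP/idP; apply: contraTT => xy.
  exact: wo_sim_lt (fs y) (fs x) xy.
exact: wo_sim_lt (wo_sim_sym (fs y)) (wo_sim_sym (fs x)) xy.
Qed.

Lemma wo_sim_total (a b : wo) :
  (forall x : a, exists y : b, wo_sim x y) -> wo_iso a b \/ wo_prec a b.
Proof.
move=> /choice[f fs]; have fm := wo_sim_mono fs.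
have [fsurj|/existsNP[y ny]] := pselect (forall y, exists x, f x = y).
  have [g gK] := choice fsurj; left; exists f => //; exists g => // x.
  by apply: (mono_wo_inj fm); rewrite gK.
have [y0 ny0 y0min] := @wo_min b (fun y => ~ exists x, f x = y) y ny.
right; exists f, y0; split=> // z; split=> [[x _ <-]|zy0]; last first.
  have [x xz] : exists x, f x = z.
    by apply: contrapT => /y0min; apply/negP.
  by exists x.
case: (wo_ltP (f x) y0) => // [fx|y0x]; first by exfalso; apply: ny0; exists x.
exfalso; apply: ny0; have [_ sy'] := wo_simP (fs x).
have [x'' _ s] := sy' _ y0x; exists x''; exact: wo_sim_fun (fs x'') s.
Qed.

Lemma wo_trichotomy (a b : wo) : [\/ wo_iso a b, wo_prec a b | wo_prec b a].
Proof.
have [/wo_sim_total[]|/existsNP[x nx]] :=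
    pselect (forall x : a, exists y : b, wo_sim x y);
  [by constructor 1|by constructor 2|].
have [x0 nx0 x0min] := @wo_min a (fun x => ~ exists y : b, wo_sim x y) x nx.
have [/wo_sim_total[/wo_iso_sym|]|/existsNP[y ny]] :=
    pselect (forall y : b, exists x : a, wo_sim y x);
  [by constructor 1|by constructor 3|].
have [y0 ny0 y0min] := @wo_min b (fun y => ~ exists x : a, wo_sim y x) y ny.
exfalso; apply: (nx0); exists y0; constructor=> [x' x'x|y' y'y].
  have [y' s] : exists y : b, wo_sim x' y.
    by apply: contrapT => /x0min; exact/negP.
  exists y' => //; case: (wo_ltP y' y0) => // [yE|yy'].
    by exfalso; apply: ny0; exists x'; rewrite -yE; exact: wo_sim_sym.
  exfalso; apply: ny0; have [_ sy'] := wo_simP s; have [z _ /wo_sim_sym ?] := sy' _ yy'.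
  by exists z.
have [x' s] : exists x : a, wo_sim y' x.
  by apply: contrapT => /y0min; exact/negP.
exists x'; last exact: wo_sim_sym.
case: (wo_ltP x' x0) => // [xE|xx'].
  by exfalso; apply: nx0; exists y'; rewrite -xE; exact: wo_sim_sym.
exfalso; apply: nx0; have [_ sx'] := wo_simP s; have [z _ /wo_sim_sym ?] := sx' _ xx'.
by exists z.
Qed.

Definition wo_isob (a b : {classic wo}) : bool := `[< wo_iso a b >].

Lemma wo_isob_refl : reflexive wo_isob.
Proof. by move=> a; apply/asboolP; exact: wo_iso_refl. Qed.

Lemma wo_isob_sym : symmetric wo_isob.
Proof. by move=> a b; apply/asboolP/asboolP; exact: wo_iso_sym. Qed.

Lemma wo_isob_trans : transitive wo_isob.
Proof.
move=> b a c /asboolP ab /asboolP bc; apply/asboolP.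
exact: wo_iso_trans ab bc.
Qed.

Canonical wo_iso_equiv := EquivRel wo_isob wo_isob_refl wo_isob_sym wo_isob_trans.

Definition Ord := {eq_quot wo_iso_equiv}.
HB.instance Definition _ := Choice.on Ord.
HB.instance Definition _ := EqQuotient.on Ord.

Definition ord_lt (al be : Ord) : bool := `[< wo_prec (repr al) (repr be) >].
Definition ord_le (al be : Ord) : bool := (al == be) || ord_lt al be.

Lemma pi_ordP (a b : wo) : \pi_Ord a = \pi_Ord b <-> wo_iso a b.
Proof. by split=> [/eqmodP/asboolP|ab]; [|apply/eqmodP/asboolP]. Qed.

Lemma repr_pi_iso (a : wo) : wo_iso (repr (\pi_Ord a)) a.
Proof. by apply/pi_ordP; rewrite reprK. Qed.

Lemma ord_ltE (a b : wo) : ord_lt (\pi_Ord a) (\pi_Ord b) <-> wo_prec a b.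
Proof.
have [ia ib] := (repr_pi_iso a, repr_pi_iso b).
split=> [/asboolP ab|ab]; last apply/asboolP.
  exact/(wo_prec_isol (wo_iso_sym ia))/(wo_prec_isor ab ib).
exact/(wo_prec_isol ia)/(wo_prec_isor ab (wo_iso_sym ib)).
Qed.

Lemma ord_lt_irr : irreflexive ord_lt.
Proof. by move=> al; apply/asboolP => /wo_prec_irr. Qed.

Lemma ord_lt_trans : transitive ord_lt.
Proof.
move=> be al ga /asboolP ab /asboolP bg; apply/asboolP.
exact: wo_prec_trans ab bg.
Qed.

Lemma ord_lt_total al be : al != be -> ord_lt al be || ord_lt be al.
Proof.
case: (wo_trichotomy (repr al) (repr be)) => [/pi_ordP|ab _|ba _].
- by rewrite !reprK => ->; rewrite eqxx.
- by apply/orP; left; apply/asboolP.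
- by apply/orP; right; apply/asboolP.
Qed.

Fact ord_display : Order.disp_t. Proof. exact: Order.Disp tt tt. Qed.

Fact ord_le_def al be : ord_le al be = (al == be) || ord_lt al be.
Proof. by []. Qed.

HB.instance Definition _ := @Order.LtOrder.Build ord_display Ord
  ord_le ord_lt _ _ ord_le_def (fun _ _ => erefl) (fun _ _ => erefl)
  ord_lt_irr ord_lt_trans ord_lt_total.
Section Segment.
Variables (a : wo) (x : a).
Let seg_sort := {y : a | wo_lt y x}.

Lemma seg_leP : well_order (fun y z : seg_sort => wo_le (val y) (val z)).
Proof.
apply: antisymmetric_well_order => [y z yz|A [y Ay]].
  by apply: val_inj; exact: wo_anti.
have [|z [u Au <-] um] := @wo_min a (fun z => exists2 u, u \in A & val u = z) (val y).
  by exists y.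
by exists u; split=> // v Av; apply: um; exists v.
Qed.

Definition wo_seg : wo := WO seg_leP.
End Segment.

Lemma wo_prec_seg (a b : wo) : wo_prec a b <-> exists y : b, wo_iso a (wo_seg y).
Proof.
split=> [[f [y0 [fm fr]]]|[y [f [g fK gK] fm]]]; last first.
  exists (val \o f), y; split=> [u v|z]; first exact: fm.
  split=> [[u _ <-]|zy]; first exact: valP (f u).
  by exists (g (exist _ z zy)); rewrite //= gK.
have fy u : wo_lt (f u) y0 by apply/fr; exists u.
have /choice[g gK] (z : wo_seg y0) : exists u, f u = val z.
  by have /fr[u _ <-] := valP z; exists u.
exists y0, (fun u => exist _ (f u) (fy u)); last by move=> u v; exact: fm.
exists g => [u|z]; last exact/val_inj/gK.
by apply: (mono_wo_inj fm); rewrite gK.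
Qed.

Theorem ord_below (a : wo) : exists2 f : a -> Ord,
  {mono f : x y / wo_le x y >-> x <= y} & range f = [set x : Ord | x < \pi_Ord a].
Proof.
pose f (x : a) := \pi_Ord (wo_seg x).
have flt x y : wo_lt x y -> f x < f y.
  move=> xy; apply/ord_ltE.
  have h (z : wo_seg x) : wo_lt (val z) y.
    exact: wo_lt_le_trans (valP z) (wo_ltW xy).
  exists (fun z => exist _ (val z) (h z)), (exist _ x xy); split=> // t.
  split=> [[z _ <-]|tx]; first exact: valP z.
  by exists (exist _ (val t) tx) => //; exact: val_inj.
have fle x y : wo_le x y -> f x <= f y.
  case: (wo_ltP x y) => [/flt/ltW //|->//|yx xy].
  by rewrite /wo_lt xy in yx.
exists f => [x y|].
  apply/idP/idP => [|/fle//]; apply: contraTT => yx.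
  by rewrite -ltNge; exact: flt.
apply/seteqP; split=> [_ [x _ <-]|y] /=.
  by apply/ord_ltE/wo_prec_seg; exists x; exact: wo_iso_refl.
rewrite -[y]reprK => /ord_ltE/wo_prec_seg[x yx].
by exists x => //; apply/pi_ordP; exact: wo_iso_sym.
Qed.

Theorem ord_well_order : well_order (<=%O : rel Ord).
Proof.
apply: antisymmetric_well_order => [|A [al Aal]]; first exact: le_anti.
have [f fm] := ord_below (repr al); rewrite reprK => fr.
have [[x Ax]|nA] := pselect (exists x, f x \in A); last first.
  exists al; split=> // be Abe; rewrite leNgt; apply/negP => beal.
  have : range f be by rewrite fr.
  by case=> x _ fx; apply: nA; exists x; rewrite fx.
have [y Ay ym] := @wo_min _ (fun x => f x \in A) x Ax.
exists (f y); split=> // be Abe.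
have [albe|beal] := leP al be.
  apply: le_trans albe; apply: ltW.
  by have : range f (f y) by []; rewrite fr.
have : range f be by rewrite fr.
by case=> z _ fz; rewrite -fz fm; apply: ym; rewrite fz.
Qed.

(** The elements of an ordinal are the smaller ordinals. *)
Definition ord_set (al : Ord) : Type := {x : Ord | x < al}.
Coercion ord_set : Ord >-> Sortclass.

HB.instance Definition _ (al : Ord) := SubChoice.on (al : Type).
HB.instance Definition _ (al : Ord) :=
  [SubChoice_isSubOrder of (al : Type) by <: with ord_display].

#[short(type="finSemigroupType")]
HB.structure Definition FinSemigroup := {S of Semigroup S & Finite S}.

Record labelling (al : Ord) (S : semigroupType) := Labelling {
  lab :> forall x y : al, x < y -> S;
  labM : forall (x y z : al) (xy : x < y) (yz : y < z) (xz : x < z),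
    (lab xy * lab yz)%g = lab xz
}.

(** [upto be] is the interval from [0] to [be], both included. *)
Definition upto (be : Ord) : Type := {x : Ord | x <= be}.

Definition upto_incl (al be : Ord) (hbe : be < al) (x : upto be) : al :=
  exist _ (val x) (le_lt_trans (valP x) hbe).

Definition lab_restrict (al : Ord) (S : semigroupType) (sigma : labelling al S)
    (be : Ord) (hbe : be < al) (x y : upto be) (xy : val x < val y) : S :=
  @lab al S sigma (upto_incl hbe x) (upto_incl hbe y) xy.

(** First-order formulas over the signature [<, p_0, ..., p_(N-1)], with
  equality, whose free variables are among [n] de Bruijn indices; a quantifier
  binds the index [ord0] of its body and shifts the other ones. *)
Inductive formula (N : nat) : nat -> Type :=
| FFalse n : formula N n
| FLt n (i j : 'I_n) : formula N n
| FEq n (i j : 'I_n) : formula N n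
| FPred n (p : 'I_N) (i : 'I_n) : formula N n
| FImp n (phi psi : formula N n) : formula N n
| FAnd n (phi psi : formula N n) : formula N n
| FOr n (phi psi : formula N n) : formula N n
| FAll n (phi : formula N n.+1) : formula N n
| FEx n (phi : formula N n.+1) : formula N n.

Fixpoint sat (d : Order.disp_t) (D : porderType d) (N : nat) (P : 'I_N -> set D)
    (n : nat) (phi : formula N n) : n.-tuple D -> Prop :=
  match phi in formula _ n return n.-tuple D -> Prop with
  | FFalse _ => fun _ => False
  | FLt _ i j => fun e => tnth e i < tnth e j
  | FEq _ i j => fun e => tnth e i = tnth e j
  | FPred _ p i => fun e => P p (tnth e i)
  | FImp _ phi psi => fun e => sat P phi e -> sat P psi e
  | FAnd _ phi psi => fun e => sat P phi e /\ sat P psi e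
  | FOr _ phi psi => fun e => sat P phi e \/ sat P psi e
  | FAll _ phi => fun e => forall x, sat P phi [tuple of x :: e]
  | FEx _ phi => fun e => exists x, sat P phi [tuple of x :: e]
  end.

Definition log2 (R : realType) (x : R) : R := (ln x / ln 2)%R.

(* Main.v *)
Require Import Defs.
From HB Require Import structures.
From mathcomp Require Import all_boot all_order all_algebra.
From mathcomp Require Import all_classical all_reals exp.

(** At a position [t], two positions [x, x' < t] are equivalent when
  [sigma x t = sigma x' t].  There are at most [#|S|] classes; equivalent
  positions remain equivalent at all later times, and a class created later has
  a larger minimum.  Hence, if the classes are ranked by their minima, the rank
  of the class of a fixed [x] can only decrease as [t] grows: it changes less
  than [#|S|] times, and has a limit at each limit position.

  Color [t] with the map from the values [sigma x t] to the ranks at [t], the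
  map from the ranks just before [t] to the values at [t], and [sigma x t] for
  the predecessor [x] of [t], if any.  This depends only on [sigma] up to [t]
  and uses [#|S| ^ (2 * #|S| + 1)] colors.  By descending induction on [j], a
  formula says that the class of [x] has rank [j] at [y]: this rank was reached
  at some [t <= y], either from a larger one or because [x] is the predecessor
  of [t], and the colors between [t] and [y] preserve it. *)

Local Open Scope order_scope.

Import Order.TTheory GRing.Theory Num.Theory.

(** * Formula combinators and their semantics *)

Section Formulas.
Context {N : nat}.

Definition FNot {n} (phi : formula N n) := FImp phi (@FFalse N n).

Definition FBigOr {n} {I : Type} (s : seq I) (F : I -> formula N n) :=
  foldr (fun i => FOr (F i)) (@FFalse N n) s.

Definition FBigAnd {n} {I : Type} (s : seq I) (F : I -> formula N n) :=
  foldr (fun i => FAnd (F i)) (FNot (@FFalse N n)) s.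

Definition FCovers {n} (x y : 'I_n) :=
  FAnd (FLt N x y)
       (FNot (FEx (FAnd (FLt N (lift ord0 x) ord0) (FLt N ord0 (lift ord0 y))))).

(** [F] ranges over all contexts because it is used under two further quantifiers; [u <= v] is
    written as the negation of [v < u]. *)
Definition FEventually {n} (F : forall m, 'I_m -> 'I_m -> formula N m) (x y : 'I_n) :=
  FEx (FAnd (FAnd (FLt N (lift ord0 x) ord0) (FLt N ord0 (lift ord0 y)))
    (FAll (FImp (FAnd (FNot (FLt N ord0 (lift ord0 ord0)))
                      (FLt N ord0 (lift ord0 (lift ord0 y))))
                (F n.+2 (lift ord0 (lift ord0 x)) ord0)))).

(** Each admissible color is spelled out by all its bits, so that any property of the color at [x]
    becomes a finite disjunction. *)
Definition FColor {C : finType} (enc : C -> {ffun 'I_N -> bool}) (Q : pred C)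
    {n} (x : 'I_n) :=
  FBigOr [seq c <- enum C | Q c] (fun c => FBigAnd (enum 'I_N) (fun p =>
    if enc c p then FPred p x else FNot (FPred p x))).

Context {d : Order.disp_t} {D : orderType d} (P : 'I_N -> set D).

Definition covers (x t : D) := x < t /\ ~ exists z, x < z /\ z < t.

Definition eventually (Q : D -> Prop) (x t : D) :=
  exists u, (x < u /\ u < t) /\ forall v, u <= v /\ v < t -> Q v.

Lemma sat_FBigOr {n} {I : eqType} (s : seq I) (F : I -> formula N n) e :
  sat P (FBigOr s F) e <-> exists2 i, i \in s & sat P (F i) e.
Proof.
elim: s => [|i s IH] /=; first by split=> // -[].
rewrite IH; split=> [[si|[j js sj]]|[j]].
- by exists i => //; rewrite mem_head.
- by exists j => //; rewrite inE js orbT.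
- by rewrite inE => /predU1P[->|js sj]; [left|right; exists j].
Qed.

Lemma sat_FBigAnd {n} {I : eqType} (s : seq I) (F : I -> formula N n) e :
  sat P (FBigAnd s F) e <-> forall i, i \in s -> sat P (F i) e.
Proof.
elim: s => [|i s IH] /=; first by split.
rewrite IH; split=> [[si sj] j|h]; first by rewrite inE => /predU1P[->//|/sj].
by split=> [|j js]; apply: h; rewrite inE ?eqxx // js orbT.
Qed.

Lemma sat_FCovers {n} (x y : 'I_n) e :
  sat P (FCovers x y) e <-> covers (tnth e x) (tnth e y).
Proof.
by rewrite /covers /=; split=> -[xy nz]; split=> // -[z zP]; apply: nz; exists z;
  move: zP; rewrite tnth0 !tnthS.
Qed.

(** [F] need only be correct at points above [x], which is all that the rank formula provides. *)
Lemma sat_FEventually {n} F (x y : 'I_n) e (Q : D -> Prop) :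
  (forall m (x' y' : 'I_m) (e' : m.-tuple D), tnth e' x' = tnth e x ->
     tnth e x < tnth e' y' -> sat P (F m x' y') e' <-> Q (tnth e' y')) ->
  sat P (FEventually F x y) e <-> eventually Q (tnth e x) (tnth e y).
Proof.
move=> FQ; split=> /= -[u [xuy uP]]; exists u; move: xuy; rewrite !tnth0 !tnthS.
  move=> [xu uy]; split=> // v [uv vy]; move: (uP v).
  rewrite !tnth0 !tnthS FQ ?tnth0 ?tnthS //.
    by apply; split=> //; rewrite ltNge uv.
  exact: lt_le_trans uv.
move=> [xu uy]; split=> // v; rewrite !tnth0 !tnthS => -[/negP uv vy].
rewrite -leNgt in uv; rewrite FQ ?tnth0 ?tnthS //; first exact: uP.
exact: lt_le_trans uv.
Qed.

Lemma sat_FColor {C : finType} (enc : C -> {ffun 'I_N -> bool}) (col : D -> C)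
    (Q : pred C) {n} (x : 'I_n) e :
  injective enc -> (forall p z, P p z <-> enc (col z) p) ->
  sat P (FColor enc Q x) e <-> Q (col (tnth e x)).
Proof.
move=> enc_inj Penc; rewrite sat_FBigOr.
have colP c : sat P (FBigAnd (enum 'I_N) (fun p =>
    if enc c p then FPred p x else FNot (FPred p x))) e <-> c = col (tnth e x).
  rewrite sat_FBigAnd; split=> [h|-> p _]; last first.
    by case: ifPn => [|/negP] encp /=; rewrite Penc.
  apply/enc_inj/ffunP => p; have := h p (mem_enum _ _).
  by case: (enc c p) => /=; rewrite Penc; [move=> ->|move/negP/negPf->].
split=> [[c + /colP <-]|Qc]; first by rewrite mem_filter => /andP[].
by exists (col (tnth e x)); [rewrite mem_filter Qc mem_enum|exact/colP].
Qed.

End Formulas.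

(** * Ranks of the classes, and how colors govern them *)

Section Ranks.
Context {d : Order.disp_t} {T : orderType d} {S : finSemigroupType} (s0 : S).

(** A class at [t] is represented by its value in [S]; these are the classes whose minimum precedes
    every member of the class of [a]. *)
Definition earlier (f : T -> T -> S) (t : T) (a : S) : {set S} :=
  [set b | `[< exists2 x, x < t & f x t = b /\ forall z, z <= x -> f z t <> a >]].

Lemma earlierP (f : T -> T -> S) t a b :
  reflect (exists2 x, x < t & f x t = b /\ forall z, z <= x -> f z t <> a)
          (b \in earlier f t a).
Proof. by rewrite finset.in_set; exact: asboolP. Qed.

(** As [a] never belongs to [earlier f t a], the cardinal is below [#|S|] and the default is never
    taken. *)
Definition rank (f : T -> T -> S) (t : T) (a : S) : 'I_#|S| :=
  insubd (enum_rank s0) #|earlier f t a|.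

Definition limit_value (f : T -> T -> S) (t : T) (j : 'I_#|S|) : S :=
  xget s0 [set a | exists2 x, f x t = a & eventually (fun v => rank f v (f x v) = j) x t].

Definition pred_value (f : T -> T -> S) (t : T) : S :=
  xget s0 [set a | exists2 x, f x t = a & covers x t].

Definition color_type : finType := ({ffun S -> 'I_#|S|} * {ffun 'I_#|S| -> S} * S)%type.

Definition color (f : T -> T -> S) (t : T) : color_type :=
  ([ffun a => rank f t a], [ffun j => limit_value f t j], pred_value f t).

Context (f : T -> T -> S).
Hypothesis T_min : forall (P : T -> Prop) x, P x ->
  exists2 y, P y & forall z, P z -> y <= z.
Hypothesis fM : forall x y z, x < y -> y < z -> (f x y * f y z)%g = f x z.

Lemma rankE x t : x < t -> rank f t (f x t) = #|earlier f t (f x t)| :> nat.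
Proof.
move=> xt; rewrite /rank insubdK // -[#|S|]cardsT; apply: proper_card.
rewrite properT; apply/eqP => /setP/(_ (f x t)); rewrite finset.in_setT.
by move=> /earlierP[z _ [zx /(_ z (lexx z))]].
Qed.

Lemma rank_inj x y t : x < t -> y < t ->
  rank f t (f x t) = rank f t (f y t) -> f x t = f y t.
Proof.
move=> xt yt rxy; apply: contrapT => fxy.
have {rxy} : #|earlier f t (f x t)| = #|earlier f t (f y t)|.
  by rewrite -!rankE // rxy.
(* Comparing the minima of the two classes, assume that the class of [x] starts first. Its set of
   earlier classes is then strictly included in the other one, which also contains [f x t]. *)
wlog [z zt [zx zy]] : x y xt yt fxy / exists2 z, z < t &
    f z t = f x t /\ forall w, w <= z -> f w t <> f y t.
  have [zx [zxt zxE] zxm] := T_min (fun z => z < t /\ f z t = f x t) x (conj xt erefl).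
  have [zy [zyt zyE] zym] := T_min (fun z => z < t /\ f z t = f y t) y (conj yt erefl).
  move=> wl; case: (ltgtP zx zy) => [xy|yx|xy].
  - apply: wl => //; exists zx => //; split=> // w wzx wE.
    by have := le_trans (zym w (conj (le_lt_trans wzx zxt) wE)) wzx; rewrite leNgt xy.
  - move/esym; apply: wl => //; first by move/esym.
    exists zy => //; split=> // w wzy wE.
    by have := le_trans (zxm w (conj (le_lt_trans wzy zyt) wE)) wzy; rewrite leNgt yx.
  - by case: fxy; rewrite -zxE xy.
apply/eqP; rewrite neq_ltn; apply/orP; left; apply: proper_card.
apply/properP; split; last first.
  exists (f x t); first by apply/earlierP; exists z.
  by apply/negP => /earlierP[w _ [wx /(_ w (lexx w))]].
apply/fintype.subsetP => b /earlierP[w wt [<- wP]].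
apply/earlierP; exists w => //; split=> // v vw; apply: zy.
by apply: le_trans vw _; rewrite leNgt; apply/negP => /ltW/wP.
Qed.

Lemma rank_homo x s t : x < s -> s <= t -> rank f t (f x t) <= rank f s (f x s).
Proof.
move=> xs; rewrite le_eqVlt => /predU1P[->//|st]; have xt := lt_trans xs st.
rewrite leEord !rankE //.
(* Every class preceding that of [x] at [t] is the image under right
  multiplication by [f s t] of one preceding it at [s]. *)
apply: leq_trans (leq_imset_card (fun b => (b * f s t)%g) _); apply: subset_leq_card.
apply/fintype.subsetP => b /earlierP[w wt [<- wP]].
have wx : w < x by rewrite ltNge; apply/negP => /wP.
have ws := lt_trans wx xs.
apply/imsetP; exists (f w s); last by rewrite fM.
apply/earlierP; exists w => //; split=> // v vw fvx.
by apply: (wP v vw); rewrite -(fM _ _ _ (le_lt_trans vw ws) st) fvx fM.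
Qed.

(** Ranks decrease with time, so the least one reached strictly between [x] and [t] is kept from
    there on. If [t] has a predecessor, it is the rank there. *)
Lemma eventually_rank x t : x < t -> ~ covers x t ->
  exists j, eventually (fun v => rank f v (f x v) = j) x t.
Proof.
move=> xt ncov.
have [z zP] : exists z, x < z /\ z < t by apply: contrapT => nz; apply: ncov.
pose Q n := `[< exists u, (x < u /\ u < t) /\ rank f u (f x u) = n :> nat >].
have exQ : exists n, Q n by exists (rank f z (f x z)); apply/asboolP; exists z.
case: (ex_minnP exQ) => n /asboolP[u [[xu ut] <-]] un.
exists (rank f u (f x u)), u; split=> // v [uv vt]; apply/le_anti.
rewrite rank_homo //= leEord; apply/un/asboolP; exists v; split=> //; split=> //.
exact: lt_le_trans uv.
Qed.

(** Two positions with the same eventual rank share a class at some [v < t] by [rank_inj];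
    multiplying by [f v t] equates their values at [t], so the choice in [limit_value] is forced. *)
Lemma limit_valueE x t j : eventually (fun v => rank f v (f x v) = j) x t ->
  limit_value f t j = f x t.
Proof.
move=> evx; rewrite /limit_value; case: xgetP => [a _ [y <- evy]|/(_ (f x t))]; last first.
  by case; exists x.
have [[u [[xu ut] uP]] [w [[yw wt] wP]]] := (evx, evy).
have vt : Order.max u w < t by rewrite gt_max ut.
have xv : x < Order.max u w by rewrite lt_max xu.
have yv : y < Order.max u w by rewrite lt_max yw orbT.
rewrite -(fM _ _ _ xv vt) -(fM _ _ _ yv vt); congr (_ * _)%g.
by apply: rank_inj => //; rewrite uP ?wP // le_max lexx ?orbT.
Qed.

Lemma pred_valueE x t : covers x t -> pred_value f t = f x t.
Proof.
move=> [xt nx]; rewrite /pred_value; case: xgetP => [a _ [y <- [yt ny]]|/(_ (f x t))].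
  case: (ltgtP x y) => [xy|yx|->//]; first by case: nx; exists y.
  by case: ny; exists x.
by case; exists x.
Qed.

Lemma value_color x t a : x < t ->
  f x t = a <-> covers x t /\ pred_value f t = a \/
    exists j, eventually (fun v => rank f v (f x v) = j) x t /\ limit_value f t j = a.
Proof.
move=> xt; split=> [<-|[[/pred_valueE->]|[j [/limit_valueE->]]]] //.
have [cov|/(eventually_rank _ _ xt)[j ev]] := pselect (covers x t).
  by left; rewrite (pred_valueE _ _ cov).
by right; exists j; rewrite (limit_valueE _ _ _ ev).
Qed.

(** Both clauses read the rank at [t] off the color of [t]; the strict [j < k] is what makes the
    recursion on ranks terminate. *)
Definition enters x t j :=
  covers x t /\ rank f t (pred_value f t) = j \/
  exists2 k, j < k & eventually (fun v => rank f v (f x v) = k) x t /\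
    rank f t (limit_value f t k) = j.

Lemma entersP x t j : enters x t j -> rank f t (f x t) = j.
Proof. by move=> [[/pred_valueE->]|[k _ [/limit_valueE->]]]. Qed.

(** By monotonicity, rank [j] at [y] has been held since the first position [t] where it
    occurred. *)
Lemma rank_color x y j : x < y ->
  rank f y (f x y) = j <-> exists t, ((x < t /\ t <= y) /\ enters x t j) /\
    forall s, t < s /\ s <= y -> rank f s (limit_value f s j) = j.
Proof.
move=> xy; split=> [rj|[t [[[xt ty] /entersP rt] stay]]]; last first.
  suff main s : (t <= s /\ s <= y) -> rank f s (f x s) = j by apply: main.
  move=> sP; apply: contrapT => ns.
  (* At the first failure [u], rank [j] holds throughout [[t, u)], so [limit_value f u j] is [f x u]
     and the color of [u] forces rank [j]. *)
  have [u [[tu uy] nu] um] := T_min (fun s => (t <= s /\ s <= y) /\ rank f s (f x s) <> j)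
    s (conj sP ns).
  move: tu; rewrite le_eqVlt => /predU1P[tu|tu]; first by rewrite -tu in nu.
  apply: nu; rewrite -[RHS](stay u) // (limit_valueE x) //.
  exists t; split=> // v [tv vu]; apply: contrapT => nv.
  have : u <= v by apply: um; split=> //; split=> //; apply: le_trans (ltW vu) uy.
  by rewrite leNgt vu.
have [t [[xt ty] rt] tm] := T_min (fun t => (x < t /\ t <= y) /\ rank f t (f x t) = j)
  y (conj (conj xy (lexx y)) rj).
exists t; split; last first.
  move=> s [ts sy]; have rs v : t <= v -> v <= y -> rank f v (f x v) = j.
    move=> tv vy; apply/le_anti; rewrite -{1}rt -{1}rj !rank_homo //.
    exact: lt_le_trans tv.
  rewrite (limit_valueE x) ?rs // ?ltW //; exists t; split=> // v [tv vs].
  by apply: rs => //; apply: le_trans (ltW vs) sy.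
split=> //; have [cov|/(eventually_rank _ _ xt)[k ev]] := pselect (covers x t).
  by left; rewrite (pred_valueE _ _ cov).
right; exists k; last by rewrite (limit_valueE _ _ _ ev).
(* The rank [k] held just before [t] is at least [j] by monotonicity, and differs from [j] because
   [t] is the first position of rank [j]. *)
have [u [[xu ut] uP]] := ev.
have <- := uP u (conj (lexx u) ut).
rewrite lt_neqAle -{2}rt rank_homo ?(ltW ut) // andbT; apply/eqP => ru.
have : t <= u by apply: tm; split=> //; split=> //; apply: le_trans (ltW ut) ty.
by rewrite leNgt ut.
Qed.

(** * Formulas defining ranks and values from the colors *)

Context {N : nat} (enc : color_type -> {ffun 'I_N -> bool}).

(* The fuel [m] makes the formula correct for the ranks [j >= #|S| - m] only. *)
Fixpoint FRank (m : nat) (j : 'I_#|S|) n (x y : 'I_n) : formula N n :=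
  if m is m'.+1 then
    let: (x', t, y') := (lift ord0 x, ord0, lift ord0 y) in
    FEx (FAnd
      (FAnd (FAnd (FLt N x' t) (FNot (FLt N y' t)))
         (FOr (FAnd (FCovers x' t) (FColor enc (fun c => c.1.1 c.2 == j) t))
            (FBigOr [seq k : 'I_#|S| <- enum 'I_#|S| | j < k] (fun k =>
               FAnd (FEventually (FRank m' k) x' t)
                    (FColor enc (fun c => c.1.1 (c.1.2 k) == j) t)))))
      (FAll (FImp (FAnd (FLt N (lift ord0 t) ord0) (FNot (FLt N (lift ord0 y') ord0)))
                  (FColor enc (fun c => c.1.1 (c.1.2 j) == j) ord0))))
  else @FFalse N n.

(** This transcribes [value_color]; fuel [#|S|] is enough for every rank, 0 included. *)
Definition FValue (a : S) {n} (x y : 'I_n) : formula N n :=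
  FOr (FAnd (FCovers x y) (FColor enc (fun c => c.2 == a) y))
      (FBigOr (enum 'I_#|S|) (fun j => FAnd (FEventually (FRank #|S| j) x y)
         (FColor enc (fun c => c.1.2 j == a) y))).

Context (P : 'I_N -> set T).
Hypothesis enc_inj : injective enc.
Hypothesis P_enc : forall p z, P p z <-> enc (color f z) p.

Lemma sat_FRank m (j : 'I_#|S|) n (x y : 'I_n) (e : n.-tuple T) :
  (#|S| <= m + j)%N -> tnth e x < tnth e y ->
  sat P (FRank m j n x y) e <-> rank f (tnth e y) (f (tnth e x) (tnth e y)) = j.
Proof.
have colE Q n' (z : 'I_n') e' := sat_FColor P enc (color f) Q z e' enc_inj P_enc.
elim: m j n x y e => [|m IH] j n x y e.
  (* Without fuel the hypothesis reads [#|S| <= j], which is absurd. *)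
  by rewrite leqNgt ltn_ord.
move=> Sm xy; rewrite rank_color //.
(* A rank above [j] needs one unit of fuel less, so the recursive calls stay correct. *)
have mk (k : 'I_#|S|) : j < k -> (#|S| <= m + k)%N.
  by rewrite ltEord => jk; apply: leq_trans Sm _; rewrite addSnnS leq_add2l.
have entersE n' (x' t : 'I_n') e' : tnth e' x' = tnth e x -> tnth e x < tnth e' t ->
    sat P (FOr (FAnd (FCovers x' t) (FColor enc (fun c => c.1.1 c.2 == j) t))
      (FBigOr [seq k : 'I_#|S| <- enum 'I_#|S| | j < k] (fun k =>
         FAnd (FEventually (FRank m k) x' t)
              (FColor enc (fun c => c.1.1 (c.1.2 k) == j) t)))) e' <->
    enters (tnth e x) (tnth e' t) j.
  move=> xE xt.
  have evE k : j < k -> sat P (FEventually (FRank m k) x' t) e' <->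
      eventually (fun v => rank f v (f (tnth e x) v) = k) (tnth e x) (tnth e' t).
    move=> jk; rewrite -xE; apply: sat_FEventually => n2 x2 y2 e2 x2E xy2.
    by have := IH k n2 x2 y2 e2 (mk k jk); rewrite x2E xE in xy2 *; exact.
  rewrite /enters; split=> [[[]|/sat_FBigOr[k]]|[[cov rj]|[k jk [ev rj]]]].
  - by move=> /(sat_FCovers P); rewrite xE => cov /colE; rewrite /= ffunE => /eqP; left.
  - rewrite mem_filter => /andP[jk _] [/(evE k jk) ev].
    by move=> /colE; rewrite /= !ffunE => /eqP; right; exists k.
  - by left; split; [apply/sat_FCovers; rewrite xE|apply/colE; rewrite /= ffunE rj].
  - right; apply/sat_FBigOr; exists k; first by rewrite mem_filter jk mem_enum.
    by split; [exact/evE|apply/colE; rewrite /= !ffunE rj].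
have {}entersE t (xt : tnth e x < t) :=
  entersE n.+1 (lift ord0 x) ord0 [tuple of t :: e] (tnthS _ _ _) xt.
split=> -[t [[[xt ty] en] stay]]; exists t.
  rewrite /= tnthS tnth0 in xt; rewrite /= tnthS tnth0 in ty.
  move/negP: ty; rewrite -leNgt => ty.
  move/(entersE _ xt): en; rewrite tnth0 => en.
  split=> // s [ts sy]; move: (stay s); rewrite /= !tnthS !tnth0.
  move=> h; have /colE : sat P (FColor enc (fun c => c.1.1 (c.1.2 j) == j) ord0)
      [tuple of s :: [tuple of t :: e]].
    by apply: h; split=> //; apply/negP; rewrite -leNgt.
  by rewrite tnth0 /= !ffunE => /eqP.
split; [split; [split|]|].
- by rewrite /= tnthS tnth0.
- by rewrite /= tnthS tnth0; apply/negP; rewrite -leNgt.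
- by apply/entersE; rewrite ?tnth0.
- move=> s; rewrite /= !tnthS !tnth0 => -[ts /negP]; rewrite -leNgt => sy.
  by apply/colE; rewrite tnth0 /= !ffunE; apply/eqP/stay.
Qed.

Lemma sat_FValue a n (x y : 'I_n) (e : n.-tuple T) : tnth e x < tnth e y ->
  sat P (FValue a x y) e <-> f (tnth e x) (tnth e y) = a.
Proof.
have colE Q (z : 'I_n) := sat_FColor P enc (color f) Q z e enc_inj P_enc.
move=> xy; rewrite value_color //.
have evE k : sat P (FEventually (FRank #|S| k) x y) e <->
    eventually (fun v => rank f v (f (tnth e x) v) = k) (tnth e x) (tnth e y).
  apply: sat_FEventually => n2 x2 y2 e2 x2E xy2.
  by have := sat_FRank _ k n2 x2 y2 e2 (leq_addr _ _); rewrite x2E; exact.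
split=> [[[]|/sat_FBigOr[k _ [/evE ev]]]|[[cov va]|[k [ev va]]]].
- by move=> /(sat_FCovers P) cov /colE/eqP; left.
- by move=> /colE; rewrite /= ffunE => /eqP; right; exists k.
- by left; split; [exact/sat_FCovers|apply/colE/eqP].
- right; apply/sat_FBigOr; exists k; rewrite ?mem_enum //.
  by split; [exact/evE|apply/colE; rewrite /= ffunE va].
Qed.

End Ranks.

(** * Determinism of the colors *)

Lemma color_local {d : Order.disp_t} {T T' : orderType d} {S : finSemigroupType}
    (s0 : S) (f : T -> T -> S) (f' : T' -> T' -> S) (h : T -> T') (t : T) :
  {mono h : x y / x <= y} -> (forall x y', y' < h x -> exists y, h y = y') ->
  (forall x y, x < y -> y <= t -> f' (h x) (h y) = f x y) ->
  color s0 f' (h t) = color s0 f t.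
Proof.
(* The image of [h] is an initial segment and the color of [t] only inspects positions up to [t], so
   its components transfer one by one. *)
move=> h_mono h_down hf; have h_lt := leW_mono h_mono.
have earlierE v a : v <= t -> earlier f' (h v) a = earlier f v a.
  move=> vt; apply/setP => b; apply/earlierP/earlierP => -[].
    move=> x' /[dup] /h_down[x <-]; rewrite h_lt => xv; rewrite hf // => -[fb nb].
    exists x => //; split=> // z zx; rewrite -hf ?(le_lt_trans zx) //.
    by apply: nb; rewrite h_mono.
  move=> x xv [fb nb]; exists (h x); rewrite ?h_lt // hf //; split=> // z'.
  rewrite le_eqVlt => /predU1P[->|]; first by rewrite hf //; apply: nb.
  move=> /[dup] /h_down[z <-]; rewrite h_lt => zx.
  by rewrite hf ?(lt_trans zx) //; apply/nb/ltW.
have rankE v a : v <= t -> rank s0 f' (h v) a = rank s0 f v a.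
  by move=> vt; rewrite /rank earlierE.
have coversE x : covers (h x) (h t) <-> covers x t.
  rewrite /covers h_lt; split=> -[xt nz]; split=> // -[z [xz zt]]; apply: nz.
    by exists (h z); rewrite !h_lt.
  by have [w wz] := h_down _ _ zt; exists w; rewrite -!h_lt wz.
have eventuallyE x j :
    eventually (fun v => rank s0 f' v (f' (h x) v) = j) (h x) (h t) <->
    eventually (fun v => rank s0 f v (f x v) = j) x t.
  split=> -[u [[xu ut] uP]].
    have [w wu] := h_down _ _ ut; rewrite -wu !h_lt in xu ut uP *.
    exists w; split=> // v [wv vt].
    rewrite -rankE ?ltW // -hf ?(ltW vt) //; last exact: lt_le_trans wv.
    by apply: uP; rewrite h_mono h_lt.
  exists (h u); rewrite !h_lt; split=> // v' [uv' /[dup] /h_down[v vE]].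
  rewrite -vE h_lt h_mono in uv' * => vt.
  rewrite rankE ?ltW // hf ?(ltW vt) //; last exact: lt_le_trans uv'.
  exact: uP.
congr (_, _, _).
- by apply/ffunP => a; rewrite !ffunE rankE.
- apply/ffunP => j; rewrite !ffunE; congr xget; apply/seteqP; split=> a /= [x].
    move=> fa ev; have [y yx] : exists y, h y = x.
      by have [u [[xu ut] _]] := ev; exact: h_down (lt_trans xu ut).
    move: fa ev; rewrite -yx => fa /eventuallyE ev; exists y => //.
    by have [u [[xu ut] _]] := ev; rewrite -hf // (lt_trans xu).
  move=> fa ev; exists (h x); last exact/eventuallyE.
  by have [u [[xu ut] _]] := ev; rewrite hf // (lt_trans xu).
- congr xget; apply/seteqP; split=> a /= [x].
    move=> fa cov; have [y yx] := h_down _ _ (proj1 cov).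
    move: fa cov; rewrite -yx => fa /coversE cov; exists y => //.
    by rewrite -hf //; exact: (proj1 cov).
  move=> fa cov; exists (h x); last exact/coversE.
  by rewrite hf //; exact: (proj1 cov).
Qed.

(** * Ordinals, the number of colors, and the theorem *)

Lemma ord_set_min (al : Ord) (P : al -> Prop) x : P x ->
  exists2 y, P y & forall z, P z -> y <= z.
Proof.
move=> Px; have [|z [[zA zm] _]] := ord_well_order
    (A := [pred z : Ord | `[< exists2 y : al, val y = z & P y >]]).
  by exists (val x); apply/asboolP; exists x.
move: zA => /asboolP[y yz Py]; exists y => // w Pw.
by change (val y <= val w); rewrite yz; apply/zm/asboolP; exists w.
Qed.

(** After taking [ln] and dividing by [ln 2], what remains is that [y] is at most the absolute value
    of its ceiling. *)
Lemma card_bits_ge (R : realType) (n : nat) : (0 < n)%N ->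
  (n ^ (2 * n + 1) <= 2 ^ `|Num.ceil ((2 * n + 1)%:R * log2 (n%:R : R))%R|)%N.
Proof.
move=> n0; set y := (_ * _)%R; rewrite -(ler_nat R) !natrX.
rewrite -ler_ln ?posrE ?exprn_gt0 ?ltr0n // !lnXn ?ltr0n //.
have ln2 : (0 < ln (2 : R))%R by rewrite ln_gt0 ?ltr1n.
have -> : (ln n%:R *+ (2 * n + 1) = y * ln (2 : R))%R.
  by rewrite /y /log2 -mulrA divfK ?gt_eqF // mulr_natl.
rewrite -[leRHS]mulr_natl ler_pM2r //.
apply: le_trans (ceil_ge y) _.
by rewrite -[leRHS]/((Posz _)%:~R)%R abszE ler_int ler_norm.
Qed.

Theorem theorem8 (R : realType) (S : finSemigroupType) :
  let N := `|Num.ceil ((2 * #|S| + 1)%:R * log2 (#|S|%:R : R))%R|%N in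
  exists (labelling_formula : S -> formula N 2)
         (X : forall al : Ord, labelling al S -> 'I_N -> set al),
    (forall (al : Ord) (sigma : labelling al S) (a : S)
            (x y : al) (xy : x < y),
       sigma x y xy = a <->
       sat (X al sigma) (labelling_formula a) [tuple x; y]) /\
    (forall (al al' : Ord) (sigma : labelling al S) (sigma' : labelling al' S)
            (be : Ord) (hbe : be < al) (hbe' : be < al'),
       lab_restrict sigma hbe = lab_restrict sigma' hbe' ->
       forall i : 'I_N,
         X al sigma i (Sub be hbe) <-> X al' sigma' i (Sub be hbe')).
Proof.
move=> N; case: (pickP (fun _ : S => true)) => [s0 _|S0]; last first.
  (* If [S] is empty, no label has to be defined, and empty predicates are deterministic. *)
  exists (fun _ => @FFalse N 2), (fun _ _ _ => set0).
  by split=> [al sigma a|//]; have := S0 a.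
(* With [n = #|S|], there are [n ^ n * n ^ n * n = n ^ (2 * n + 1)] colors, hence [N] bits can
   encode them. *)
have cardC : (#|color_type (S := S)| <= #|{ffun 'I_N -> bool}|)%N.
  rewrite !card_prod !card_ffun !card_ord card_bool -expnD -expnSr addnn -mul2n -addn1.
  by apply: card_bits_ge; apply/card_gt0P; exists s0.
pose enc c := enum_val (widen_ord cardC (enum_rank c)).
have enc_inj : injective enc.
  by move=> c c' /enum_val_inj/(congr1 val)/= /val_inj/enum_rank_inj.
(* The labelling is made total; colors evaluate it only at pairs [x < y], so the default [s0] never
   enters them. *)
pose ext al (sigma : labelling al S) (x y : al) :=
  if pselect (x < y) is left xy then sigma x y xy else s0.
have extE al (sigma : labelling al S) x y (xy : x < y) : ext al sigma x y = sigma x y xy.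
  rewrite /ext; case: pselect => [xy'|/(_ xy)//].
  by rewrite (bool_irrelevance xy' xy).
exists (fun a => FValue enc a ord0 ord_max).
exists (fun (al : Ord) (sigma : labelling al S) p (z : al) =>
  enc (color s0 (ext al sigma) z) p : Prop).
split=> [al sigma a x y xy|al al' sigma sigma' be hbe hbe' hE i].
  rewrite (sat_FValue s0 (ext al sigma)) //= -?extE //.
  - exact: ord_set_min.
  - move=> u v w uv vw; have uw := lt_trans uv vw.
    by rewrite !extE labM.
have {}hE (x y : al) (x' y' : al') : x < y -> val y <= be -> val x = val x' ->
    val y = val y' -> ext al sigma x y = ext al' sigma' x' y'.
  move=> xy ybe xx' yy'.
  pose u : upto be := exist _ (val x) (le_trans (ltW (xy : val x < val y)) ybe).
  pose v : upto be := exist _ (val y) ybe.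
  have uv : val u < val v := xy.
  have [-> ->] : x = upto_incl hbe u /\ y = upto_incl hbe v by split; exact: val_inj.
  have [-> ->] : x' = upto_incl hbe' u /\ y' = upto_incl hbe' v.
    by split; exact: val_inj.
  rewrite (extE al sigma (upto_incl hbe u) (upto_incl hbe v) uv).
  rewrite (extE al' sigma' (upto_incl hbe' u) (upto_incl hbe' v) uv).
  by have := congr1 (fun F : forall u v : upto be, val u < val v -> S => F u v uv) hE.
suff -> : color s0 (ext al sigma) (Sub be hbe) =
    color s0 (ext al' sigma') (Sub be hbe') by [].
(* By symmetry the smaller ordinal may be [al]; its inclusion into [al'] is then an initial
   embedding, as [color_local] requires. *)
wlog le_al : al al' sigma sigma' hbe hbe' hE / al <= al'.
  move=> wl; have [/wl|/ltW/wl h] := leP al al'; first exact.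
  apply/esym/h => x y x' y' xy ybe xx' yy'; apply/esym/hE; rewrite -?yy' //.
  by change (val x' < val y'); rewrite -xx' -yy'.
pose h (x : al) : al' := Sub (val x) (lt_le_trans (valP x) le_al).
have <- : h (Sub be hbe) = Sub be hbe' by exact: val_inj.
apply/esym/color_local => [//|x y' y'x|x y xy ybe].
  by exists (Sub (val y') (lt_trans (y'x : val y' < val x) (valP x))); exact: val_inj.
by apply/esym/hE.
Qed.
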